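(* Let $\mathcal M(q)$ be a finite Möbius plane of order $q$. Then \[\mu(\mathcal M(q))\ge\left\lceil 2q-4+\frac{8}{q+2}\right\rceil\ge 2q-3.\] Moreover, if $q\ge 156$, then every resolving set of minimum cardinality of the incidence graph of $\mathcal M(q)$ contains at least $2q-4$ circles.
   Context: A Möbius plane is a pair $(\mathcal P,\mathcal Z)$, where $\mathcal P$ is a set (of points) and $\mathcal Z$ is a set of subsets of $\mathcal P$ (circles), such that: (i) any three pairwise distinct points lie on exactly one circle; (ii) if $z\in\mathcal Z$, $P\in z$ and $Q\in\mathcal P\setminus z$, there is exactly one circle $z'$ through $P$ and $Q$ with $z\cap z'=\{P\}$; (iii) there is at least one circle and every circle has at least three points; (iv) for every circle $z$ there is a point not on $z$. It is finite if $\mathcal P$ is finite; then all circles have the same number $q+1$ of points, and $q$ is the order. The point-circle incidence graph $G$ has vertex set $V=\mathcal P\cup\mathcal Z$ and edges $\{P,z\}$ with $P\in z$, with shortest-path distance $d$. A set $S\subseteq V$ resolves $W\subseteq V$ if for any two distinct $u,v\in W$ there is $s\in S$ with $d(u,s)\ne d(v,s)$; $S$ is a resolving set if it resolves $V$. $\mu(\mathcal M(q))$ denotes the minimum cardinality of a resolving set of $G$. *)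

(* Defs.v *)
From mathcomp Require Import all_boot all_order all_algebra.

Set Implicit Arguments.
Unset Strict Implicit.
Unset Printing Implicit Defensive.

Section MetricDimension.

Variables (V : finType) (e : rel V).

Definition has_walk (x y : V) (n : nat) : bool :=
  [exists p : n.-tuple V, path e x p && (last x p == y)].

(* A shortest path has fewer than #|V| edges, so the search is exhaustive; the *)
(* value is #|V| exactly when y is not reachable from x.                       *)
Definition gdist (x y : V) : nat := find (has_walk x y) (iota 0 #|V|).

Definition resolves (S W : {set V}) : bool :=
  [forall u in W, forall v in W, (u != v) ==>
     [exists s in S, gdist u s != gdist v s]].

Definition resolving_set (S : {set V}) : bool := resolves S [set: V].

(* [set: V] is always resolving (resolving_setT below), so this is a genuine   *)
(* minimum; see metric_dimension_attained and metric_dimension_min.            *)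
Definition metric_dimension : nat :=
  #|[arg min_(S < [set: V] | resolving_set S) #|S| ]|.

Lemma gdist_eq0 (x y : V) : (gdist x y == 0) = (x == y).
Proof.
have: 0 < #|V| by apply/card_gt0P; exists x.
rewrite /gdist; case: #|V| => [//|n] _ /=.
suff -> : has_walk x y 0 = (x == y) by case: (x == y).
apply/existsP/eqP => [[p]|->]; first by rewrite tuple0 /= => /eqP.
by exists [tuple]; rewrite /= eqxx.
Qed.

Lemma resolving_setT : resolving_set [set: V].
Proof.
apply/forall_inP => u _; apply/forall_inP => v _; apply/implyP => uv.
apply/exists_inP; exists u; first exact: in_setT.
have /eqP -> : gdist u u == 0 by rewrite gdist_eq0.
by rewrite eq_sym gdist_eq0 eq_sym.
Qed.

Lemma metric_dimension_attained :
  exists2 S : {set V}, resolving_set S & #|S| = metric_dimension.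
Proof.
rewrite /metric_dimension; case: arg_minnP; first exact: resolving_setT.
by move=> S resS _; exists S.
Qed.

Lemma metric_dimension_min (S : {set V}) :
  resolving_set S -> metric_dimension <= #|S|.
Proof.
rewrite /metric_dimension; case: arg_minnP; first exact: resolving_setT.
by move=> S0 _; apply.
Qed.

End MetricDimension.

Record mobius_plane (P : finType) (Z : {set {set P}}) : Prop := MobiusPlane {
  mobius_join : forall A B C : P, A != B -> A != C -> B != C ->
    exists! z : {set P}, z \in Z /\ [/\ A \in z, B \in z & C \in z];
  mobius_touch : forall (z : {set P}) (A B : P),
    z \in Z -> A \in z -> B \notin z ->
    exists! z' : {set P}, [/\ z' \in Z, A \in z', B \in z' & z :&: z' = [set A]];
  mobius_exists_circle : exists z : {set P}, z \in Z;
  mobius_circle_ge3 : forall z : {set P}, z \in Z -> 3 <= #|z|;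
  mobius_proper : forall z : {set P}, z \in Z -> exists A : P, A \notin z
}.

(* Z is nonempty for a Moebius plane, so q is determined by Z.                 *)
Definition mobius_order (P : finType) (Z : {set {set P}}) (q : nat) : Prop :=
  forall z : {set P}, z \in Z -> #|z| = q.+1.

Definition circle (P : finType) (Z : {set {set P}}) : finType :=
  {z : {set P} | z \in Z}.

Definition vertex (P : finType) (Z : {set {set P}}) : finType :=
  (P + circle Z)%type.

Definition incidence (P : finType) (Z : {set {set P}}) : rel (vertex Z) :=
  fun u v => match u, v with
             | inl A, inr z => A \in val z
             | inr z, inl A => A \in val z
             | _, _ => false
             end.
Arguments incidence {P} Z.

Definition circles_in (P : finType) (Z : {set {set P}}) (S : {set vertex Z}) :
  {set circle Z} := [set z : circle Z | (inr z : vertex Z) \in S].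

(* Main.v *)
Require Import Defs.
From mathcomp Require Import all_boot all_order all_algebra zify ring.
Import Order.TTheory GRing.Theory Num.Theory.

(* Lower bound.  Points outside a resolving set S are told apart only by which  *)
(* circles of S contain them.  With c circles and p points in S, at most one    *)
(* such point is on no circle of S and at most c are on exactly one, so         *)
(* counting incidences gives 2 q^2 <= c (q + 2) + 2 p, whence                   *)
(* |S| >= 2 q^2 / (q + 2); moreover c <= 2 q - 5 forces 2 |S| >= 5 q.           *)
(*                                                                              *)
(* For q >= 156 there is a resolving set with 2 |S| < 5 q.  Two pencils of      *)
(* mutually tangent circles at a point (2 q circles) resolve the points.  For   *)
(* any two circles, at least 2/5 of all circles meet exactly one of them, so    *)
(* a greedy choice of q / 2 - 1 further circles leaves at most                  *)
(* (3/5)^(q / 2 - 1) |Z|^2 < 1 pairs of circles unresolved.                     *)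

Set Implicit Arguments.
Unset Strict Implicit.
Unset Printing Implicit Defensive.

(** Both halves rest on the inequality of [resolving_set_weight], where a circle of S has weight q +
    2 and a point only weight 2. Raising every weight to q + 2 gives |S| >= 2 q^2 / (q + 2), which
    is the first bound. Written as 2 |S| >= q (2 q - c), with c the number of circles in S, it shows
    that few circles make S large. [metric_dimension_upper] contradicts this for c <= 2 q - 5 by a
    small resolving set made of circles only: [point_resolving_circles] tells points apart by
    coordinates in the affine plane derived at a point, and [circle_resolving_circles] tells circles
    apart by feeding the count of [card_separating_circles] into [greedy_hitting_set]. *)

(** * Double counting and greedy selection *)

Lemma double_counting (A B : finType) (D : {set A}) (E : {set B})
    (r : A -> B -> bool) :
  \sum_(a in D) #|[set b in E | r a b]| = \sum_(b in E) #|[set a in D | r a b]|.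
Proof.
under eq_bigr => a _ do rewrite -sum1dep_card.
rewrite (exchange_big_dep (mem E)) /=; last by move=> a b _ /andP[].
by apply: eq_bigr => b bE; rewrite -sum1dep_card; apply: eq_bigl => a; rewrite bE.
Qed.

Lemma card_exists_unique (T : finType) (p : pred T) :
  (exists! x, p x) -> #|[set x | p x]| = 1.
Proof.
case=> x [px ux]; apply/eqP/cards1P; exists x; apply/setP => y.
by rewrite !inE; apply/idP/eqP => [/ux|->].
Qed.

(* Some b hits at least the fraction s / t of the elements not yet hit.        *)
Lemma greedy_hitting_set (A B : finType) (D : {set A}) (r : A -> B -> bool)
    (s t : nat) :
    0 < #|B| -> s <= t ->
    (forall a, a \in D -> s * #|B| <= t * #|[set b | r a b]|) ->
  forall k, exists2 T : {set B}, #|T| <= k &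
    t ^ k * #|[set a in D | ~~ [exists b in T, r a b]]| <= (t - s) ^ k * #|D|.
Proof.
move=> B0 st hr; elim=> [|k [T Tk hT]].
  exists set0; first by rewrite cards0.
  by rewrite !expn0 !mul1n subset_leq_card //; apply/subsetP => a; rewrite inE => /andP[].
set U := [set a in D | _] in hT.
(* Averaging: if every b fell short, summing over b would contradict the sum of [hr] over the
   elements of U. *)
have [b hb] : exists b, s * #|U| <= t * #|[set a in U | r a b]|.
  apply/existsP; apply: contraT => /existsPn hall.
  have [U0|/card_gt0P[a0 _]] := posnP #|U|.
    by case/card_gt0P: B0 => b _; have := hall b; rewrite U0 muln0.
  have : s * #|U| * #|B| <= t * \sum_(b in [set: B]) #|[set a in U | r a b]|.
    rewrite -double_counting big_distrr /= mulnAC mulnC -sum_nat_const.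
    apply: leq_sum => a; rewrite inE => /andP[aD _].
    rewrite (leq_trans (hr a aD)) // leq_mul2l.
    by apply/orP; right; apply: subset_leq_card; apply/subsetP => b; rewrite !inE.
  rewrite leqNgt; apply: contraNT => _; rewrite big_distrr /= -cardsT.
  rewrite mulnC -sum_nat_const.
  case/card_gt0P: B0 => b0 _.
  rewrite [X in X < _](bigD1 b0) ?inE //= [X in _ < X](bigD1 b0) ?inE //=.
  rewrite -addSn leq_add //; first by rewrite ltnNge hall.
  by apply: leq_sum => b _; apply: ltnW; rewrite ltnNge hall.
exists (b |: T); first by rewrite cardsU1; case: (b \notin T); rewrite ?ltnS // (leq_trans Tk).
set V := [set a in D | _].
have VU : #|V| + #|[set a in U | r a b]| <= #|U|.
  rewrite -cardsUI; apply: (@leq_trans (#|U| + #|set0 : {set A}|)); last by rewrite cards0 addn0.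
  rewrite leq_add ?subset_leq_card //; apply/subsetP => a; rewrite !inE.
    case/orP=> [/andP[-> /negP hV]|/andP[] //=].
    apply/negP => /exists_inP[c cT rc]; apply: hV; apply/exists_inP.
    by exists c; rewrite // !inE cT orbT.
  case/andP=> /andP[_ /negP hV] /andP[_ rb]; exfalso; apply: hV.
  by apply/exists_inP; exists b; rewrite // !inE eqxx.
have {}VU : t * #|V| <= (t - s) * #|U| by rewrite mulnBl; nia.
rewrite !expnS mulnAC (leq_trans (n := t ^ k * ((t - s) * #|U|))) //.
  by rewrite mulnC leq_mul2l VU orbT.
by rewrite mulnCA -mulnA leq_mul2l hT orbT.
Qed.

(** * Graph distance in terms of walks *)

Section Distance.
Variables (V : finType) (e : rel V).

Lemma has_walk0 (x y : V) : has_walk e x y 0 = (x == y).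
Proof.
apply/existsP/eqP => [[p]|->]; first by rewrite tuple0 /= => /eqP.
by exists [tuple]; rewrite /= eqxx.
Qed.

Lemma has_walkS (x y : V) n :
  has_walk e x y n.+1 = [exists z, e x z && has_walk e z y n].
Proof.
apply/existsP/existsP => [[p]|[z /andP[xz /existsP[p hp]]]].
  case: (tupleP p) => z p' /=; rewrite -andbA => /andP[xz hp].
  by exists z; rewrite xz; apply/existsP; exists p'.
by exists [tuple of z :: p]; rewrite /= xz.
Qed.

Lemma has_walk1 (x y : V) : has_walk e x y 1 = e x y.
Proof.
rewrite has_walkS; apply/existsP/idP => [[z]|xy]; last by exists y; rewrite xy has_walk0 /=.
by rewrite has_walk0 => /andP[xz /eqP <-].
Qed.

Lemma gdist_le (x y : V) n : n < #|V| -> has_walk e x y n -> gdist e x y <= n.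
Proof.
move=> nV w; rewrite leqNgt; apply/negP => /(before_find 0).
by rewrite nth_iota // add0n w.
Qed.

(** The value [#|V|] stands for an unreachable vertex; below it the search has stopped at the length
    of an actual walk. *)
Lemma has_walk_gdist (x y : V) : gdist e x y < #|V| -> has_walk e x y (gdist e x y).
Proof.
move=> lt; have := lt; rewrite -{1}[#|V|](size_iota 0) -has_find => /(nth_find 0).
by rewrite nth_iota ?add0n.
Qed.

Lemma gdist_eq (x y : V) n : n < #|V| -> has_walk e x y n ->
  (forall m, m < n -> ~~ has_walk e x y m) -> gdist e x y = n.
Proof.
move=> nV w hm; apply/eqP; rewrite eqn_leq gdist_le //= leqNgt; apply/negP => lt.
by move: (hm _ lt); rewrite has_walk_gdist // (ltn_trans lt).
Qed.

End Distance.

Lemma gdist_eq1 (V : finType) (e : rel V) (x y : V) :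
  1 < #|V| -> irreflexive e -> (gdist e x y == 1) = e x y.
Proof.
move=> V1 irr; apply/eqP/idP => [d1|xy].
  by rewrite -has_walk1 -d1 has_walk_gdist // d1.
apply: gdist_eq => //; first by rewrite has_walk1.
by case=> // _; rewrite has_walk0; apply: contraTneq xy => ->; rewrite irr.
Qed.

Lemma card_sum_set (T U : finType) (S : {set T + U}) :
  #|S| = #|[set x | inl x \in S]| + #|[set y | inr y \in S]|.
Proof. by rewrite -!sum1dep_card -sum1_card big_sumType. Qed.

(** * Numerical estimate for the number of greedy rounds *)

(** The case k = 77 of the next lemma, with x = 3, y = 5 and 79 = 77 + 2. Keeping x and y as
    variables leaves only 79 <= 3^4 and 2 * 3^8 < 5^6 to be evaluated. *)
Lemma greedy_rounds_base (x y : nat) : 0 < x <= y -> 79 <= x ^ 4 ->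
  2 * x ^ 8 < y ^ 6 -> 2 ^ 6 * 79 ^ 6 * x ^ 77 < y ^ 77.
Proof.
case/andP=> x0 xy h4 h8.
have h12 : 2 * x ^ 16 < y ^ 12.
  rewrite (_ : 16 = 8 + 8) // (_ : 12 = 6 + 6) // !expnD mulnA ltn_mul //.
  by apply: leq_ltn_trans h8; rewrite leq_pmull.
have e77 n : n ^ 77 = (n ^ 12) ^ 6 * n ^ 5 by rewrite -expnM -expnD.
rewrite !e77.
apply: (@leq_ltn_trans ((2 * x ^ 16) ^ 6 * x ^ 5)); last first.
  rewrite (@leq_trans ((y ^ 12) ^ 6 * x ^ 5)) //.
    by rewrite ltn_mul2r expn_gt0 x0 ltn_exp2r.
  by rewrite leq_mul2l leq_exp2r // xy orbT.
rewrite expnMn mulnA leq_mul // -mulnA leq_mul //.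
apply: (@leq_trans ((x ^ 4) ^ 6 * (x ^ 12) ^ 6)).
  by rewrite leq_mul2r leq_exp2r // h4 orbT.
by rewrite -!expnM -expnD.
Qed.

(** For k = q / 2 - 1, the factor (2 (k + 2))^6 bounds the number of pairs of circles, so k rounds
    that each keep at most 3/5 of the pairs leave none. From q >= 156 follows k >= 77. *)
Lemma greedy_rounds_suffice (k : nat) :
  77 <= k -> 2 ^ 6 * (k + 2) ^ 6 * 3 ^ k < 5 ^ k.
Proof.
elim: k => // k IH; rewrite leq_eqVlt => /orP[/eqP <-|k77].
  exact: greedy_rounds_base.
(* Here ((k + 3) / (k + 2))^2 <= 7/6, and (7/6)^3 < 5/3. *)
have step : (k.+1 + 2) ^ 6 * 3 <= (k + 2) ^ 6 * 5.
  have h2 : 6 * (k.+1 + 2) ^ 2 <= 7 * (k + 2) ^ 2 by rewrite -!mulnn; nia.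
  have := leq_exp2r (6 * (k.+1 + 2) ^ 2) (7 * (k + 2) ^ 2) (isT : 0 < 3).
  rewrite h2 (expnMn 6) (expnMn 7) -!expnM.
  move: ((k.+1 + 2) ^ (2 * 3)) ((k + 2) ^ (2 * 3)) => a b; lia.
have := IH k77; rewrite !expnS; move: step.
move: ((k.+1 + 2) ^ 6) ((k + 2) ^ 6) (3 ^ k) (5 ^ k) (2 ^ 6) => a b c d s.
nia.
Qed.

(** * Incidence counts in a Möbius plane *)

Section MobiusPlane.
Variables (P : finType) (Z : {set {set P}}) (q : nat).
Hypotheses (hZ : mobius_plane Z) (hq : mobius_order Z q).

Lemma circle_uniq (A B C : P) (z w : {set P}) :
  A != B -> A != C -> B != C -> z \in Z -> w \in Z ->
  A \in z -> B \in z -> C \in z -> A \in w -> B \in w -> C \in w -> z = w.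
Proof.
move=> AB AC BC zZ wZ Az Bz Cz Aw Bw Cw.
have [x [_ ux]] := mobius_join hZ AB AC BC.
by rewrite -(ux z) // -(ux w).
Qed.

Lemma touching_circle_uniq (z w w' : {set P}) (A B : P) :
  z \in Z -> w \in Z -> w' \in Z -> z :&: w = [set A] -> z :&: w' = [set A] ->
  B != A -> B \in w -> B \in w' -> w = w'.
Proof.
move=> zZ wZ w'Z zw zw' BA Bw Bw'.
have /setIP[Az Aw] : A \in z :&: w by rewrite zw set11.
have /setIP[_ Aw'] : A \in z :&: w' by rewrite zw' set11.
have Bz : B \notin z.
  apply: contra BA => Bz; have : B \in z :&: w by rewrite inE Bz.
  by rewrite zw inE.
have [x [_ ux]] := mobius_touch hZ zZ Az Bz.
by rewrite -(ux w) // -(ux w').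
Qed.

Lemma card_circleI (z w : {set P}) :
  z \in Z -> w \in Z -> z != w -> #|z :&: w| <= 2.
Proof.
move=> zZ wZ; apply: contraR; rewrite -ltnNge => /card_gt2P[A [B [C]]].
case=> [[/setIP[Az Aw] /setIP[Bz Bw] /setIP[Cz Cw]] [AB BC CA]].
by apply/eqP; apply: (@circle_uniq A B C) => //; rewrite eq_sym.
Qed.

Lemma order_gt1 : 1 < q.
Proof.
have [z zZ] := mobius_exists_circle hZ.
by have := mobius_circle_ge3 hZ zZ; rewrite hq.
Qed.

Lemma third_point (A B : P) : A != B -> exists C, [/\ C != A & C != B].
Proof.
move=> AB; have [z zZ] := mobius_exists_circle hZ.
have /card_gt0P[C] : 0 < #|z :\: [set A; B]|.
  have := cardsID [set A; B] z; rewrite (hq zZ).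
  have := subset_leq_card (subsetIr z [set A; B]); rewrite cards2 AB.
  by have := order_gt1; lia.
by rewrite !inE negb_or => /andP[/andP[CA CB] _]; exists C.
Qed.

(** A circle through A, C and a point off the circle ABC cannot contain B. *)
Lemma circle_separating (A B : P) : A != B ->
  exists z, [/\ z \in Z, A \in z & B \notin z].
Proof.
move=> AB; have [C [CA CB]] := third_point AB.
have AC : A != C by rewrite eq_sym.
have BC : B != C by rewrite eq_sym.
have [z [[zZ [Az Bz Cz]] _]] := mobius_join hZ AB AC BC.
have [D Dz] := mobius_proper hZ zZ.
have AD : A != D by apply: contraNneq Dz => <-.
have CD : C != D by apply: contraNneq Dz => <-.
have [w [[wZ [Aw Cw Dw]] _]] := mobius_join hZ AC AD CD.
exists w; split=> //; apply: contra Dz => Bw.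
by rewrite (@circle_uniq A B C z w).
Qed.

Lemma card_through3 (A B C : P) : A != B -> A != C -> B != C ->
  #|[set z in [set z in Z | (A \in z) && (B \in z)] | C \in z]| = 1.
Proof.
move=> AB AC BC.
rewrite -(@card_exists_unique _ (fun z => (z \in Z) && [&& A \in z, B \in z & C \in z])).
  by apply: eq_card => z; rewrite !inE -!andbA.
have [z [[zZ [Az Bz Cz]] uz]] := mobius_join hZ AB AC BC.
exists z; split; first by rewrite zZ Az Bz.
by move=> w /and4P[wZ Aw Bw Cw]; apply: uz.
Qed.

(** Take a circle z through A that misses B. Each of the q other points of z lies on one circle
    through A and B, and each such circle contains exactly one of these points, except the circle
    tangent to z at A, which contains none. *)
Lemma card_through2 (A B : P) : A != B ->
  #|[set z in Z | (A \in z) && (B \in z)]| = q.+1.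
Proof.
move=> AB; have [z [zZ Az Bz]] := circle_separating AB.
have [t [[tZ At Bt zt] ut]] := mobius_touch hZ zZ Az Bz.
set W := [set w in Z | _].
have tW : t \in W by rewrite inE tZ At.
have : \sum_(C in z :\ A) #|[set w in W | C \in w]| = q.
  have := cardsD1 A z; rewrite Az hq // add1n => -[->].
  rewrite -sum1_card; apply: eq_bigr => C /setD1P[CA Cz].
  rewrite card_through3 // 1?eq_sym //.
  by apply: contraNneq Bz => <-.
rewrite double_counting (bigD1 t) //= => hs.
rewrite (cardsD1 t) tW add1n -hs; congr _.+1.
have -> : #|[set C in z :\ A | C \in t]| = 0.
  apply/eqP; rewrite cards_eq0; apply/eqP/setP => C; rewrite !inE.
  apply/negP => /andP[/andP[CA Cz] Ct].
  have : C \in z :&: t by rewrite inE Cz.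
  by rewrite zt inE (negPf CA).
rewrite add0n -sum1_card; apply: eq_big => [w|w]; first by rewrite !inE andbC.
case/setD1P=> wt; rewrite inE => /and3P[wZ Aw Bw].
have := cardsD1 A (z :&: w); rewrite inE Az Aw add1n => hzw.
have -> : [set C in z :\ A | C \in w] = (z :&: w) :\ A.
  by apply/setP => C; rewrite !inE andbA.
have zw : z != w by apply: contraNneq Bz => ->.
have := card_circleI zZ wZ zw; rewrite hzw ltnS.
have [/eqP|] := posnP #|(z :&: w) :\ A|; last by lia.
rewrite cards_eq0 => /eqP h0 _; case/eqP: wt; apply/esym/ut; split=> //.
by rewrite -[z :&: w](@setD1K _ A) ?h0 ?setU0 // inE Az.
Qed.

Lemma two_points : exists A B : P, A != B.
Proof.
have [z zZ] := mobius_exists_circle hZ.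
have : 1 < #|z| by rewrite hq // ltnS; exact: ltnW order_gt1.
by case/card_gt1P=> A [B [_ _ AB]]; exists A, B.
Qed.

(** The q + 1 circles through A and B partition the remaining points into classes of size q - 1. *)
Lemma card_points : #|P| = (q ^ 2).+1.
Proof.
have [A [B AB]] := two_points.
set W := [set w in Z | (A \in w) && (B \in w)].
have : \sum_(C in ~: [set A; B]) #|[set w in W | C \in w]| = #|~: [set A; B]|.
  rewrite -sum1_card; apply: eq_bigr => C; rewrite !inE negb_or => /andP[CA CB].
  by rewrite card_through3 // eq_sym.
rewrite double_counting (eq_bigr (fun=> q.-1)); last first.
  move=> w; rewrite inE => /and3P[wZ Aw Bw].
  have := cardsID [set A; B] w; rewrite (hq wZ) (setIidPr _); last first.
    by apply/subsetP => C; rewrite !inE => /orP[] /eqP ->.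
  rewrite cards2 AB => h.
  have -> : [set a in ~: [set A; B] | a \in w] = w :\: [set A; B].
    by apply/setP => C; rewrite !inE andbC.
  by lia.
rewrite sum_nat_const card_through2 //.
have := cardsC [set A; B]; rewrite cards2 AB -mulnn.
have := order_gt1.
case: q => // m; nia.
Qed.

Lemma card_through1 (A : P) : #|[set z in Z | A \in z]| = q * q.+1.
Proof.
set W := [set w in Z | _].
have : \sum_(B in [set~ A]) #|[set w in W | B \in w]| = q ^ 2 * q.+1.
  have := cardsC1 A; rewrite card_points /= => <-; rewrite -sum_nat_const.
  apply: eq_bigr => B; rewrite !inE eq_sym => AB.
  by rewrite -(card_through2 AB); apply: eq_card => w; rewrite !inE andbA.
rewrite double_counting (eq_bigr (fun=> q)); last first.
  move=> w; rewrite inE => /andP[wZ Aw].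
  have := cardsD1 A w; rewrite Aw hq // add1n => -[->].
  by apply: eq_card => B; rewrite !inE.
rewrite sum_nat_const; have := order_gt1 => q1 h.
by apply/eqP; rewrite -(eqn_pmul2r (ltnW q1)) h -mulnn mulnAC.
Qed.

Lemma card_circles : #|Z| = q * (q ^ 2).+1.
Proof.
have : \sum_(A in [set: P]) #|[set z in Z | A \in z]| = (q ^ 2).+1 * (q * q.+1).
  rewrite -card_points -cardsT -sum_nat_const.
  by apply: eq_bigr => A _; rewrite card_through1.
rewrite double_counting (eq_bigr (fun=> q.+1)); last first.
  by move=> w wZ; rewrite -(hq wZ); apply: eq_card => B; rewrite !inE.
rewrite sum_nat_const mulnA => /eqP; rewrite eqn_pmul2r // => /eqP ->.
by rewrite mulnC.
Qed.

(* Sum 2 [|z :&: w| = 0] + |z :&: w| + [|z :&: w| = 1] >= 2 over the circles w   *)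
(* through A.                                                                  *)
Lemma card_through_disjoint (A : P) (z : {set P}) : z \in Z -> A \notin z ->
  q.+1 * (q - 2) <= 2 * #|[set w in Z | (A \in w) && (z :&: w == set0)]|.
Proof.
move=> zZ Az; set W := [set w in Z | A \in w].
have sI : \sum_(w in W) #|z :&: w| = q.+1 * q.+1.
  have -> : \sum_(w in W) #|z :&: w| = \sum_(w in W) #|[set B in z | B \in w]|.
    by apply: eq_bigr => w _; apply: eq_card => B; rewrite !inE.
  rewrite -double_counting -[X in _ = X * _](hq zZ) -sum_nat_const.
  apply: eq_bigr => B Bz.
  have BA : A != B by apply: contraNneq Az => ->.
  by rewrite -(card_through2 BA); apply: eq_card => w; rewrite !inE andbA.
(* Tangent circles are counted by their point of contact: for each B on z, exactly one circle
   through A touches z at B. *)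
have sT : \sum_(w in W) (#|z :&: w| == 1) = q.+1.
  transitivity (\sum_(B in z) #|[set w in W | z :&: w == [set B]]|).
    rewrite double_counting; apply: eq_bigr => w _.
    case: eqP => [/eqP/cards1P[B zwB]|nt].
      have Bz : B \in z by have := set11 B; rewrite -zwB inE => /andP[].
      apply/esym/eqP/cards1P; exists B; apply/setP => C; rewrite !inE zwB.
      by rewrite (inj_eq set1_inj) eq_sym; case: eqP => [->|]; rewrite ?Bz ?andbF.
    apply/esym/eqP; rewrite cards_eq0; apply/eqP/setP => C; rewrite !inE.
    by apply/andP => -[_ /eqP zw]; apply: nt; rewrite zw cards1.
  rewrite -(hq zZ) -sum1_card; apply: eq_bigr => B Bz.
  rewrite -(@card_exists_unique _ (fun w => [&& w \in W & z :&: w == [set B]])).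
    by [].
  have [t [[tZ Bt At zt] ut]] := mobius_touch hZ zZ Bz Az.
  exists t; split; first by rewrite inE tZ At zt eqxx.
  move=> w /andP[]; rewrite inE => /andP[wZ Aw] /eqP zw; apply: ut; split=> //.
  by have := set11 B; rewrite -zw inE => /andP[].
have sD : \sum_(w in W) (z :&: w == set0) =
    #|[set w in Z | (A \in w) && (z :&: w == set0)]|.
  rewrite -sum1dep_card big_mkcond [RHS]big_mkcond /=; apply: eq_bigr => w _.
  by rewrite !inE andbA; case: (_ && _); case: eqP.
have : 2 * #|W| <= 2 * \sum_(w in W) (z :&: w == set0) +
    \sum_(w in W) #|z :&: w| + \sum_(w in W) (#|z :&: w| == 1).
  rewrite big_distrr -!big_split mulnC -sum_nat_const; apply: leq_sum => w _.
  by rewrite -cards_eq0 /=; case: #|_| => [|[|m]].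
rewrite sI sT sD card_through1.
case: q order_gt1 => [|[|m]] // _; nia.
Qed.

(** Sum the previous bound over the at least q - 1 points of z1 off z2. A circle is counted at most
    twice, except z1 itself, possibly counted q + 1 times; this causes the correction term. *)
Lemma card_meeting_disjoint (z1 z2 : {set P}) : z1 \in Z -> z2 \in Z -> z1 != z2 ->
  q.-1 * (q.+1 * (q - 2)) <=
    4 * #|[set w in Z | (z1 :&: w != set0) && (z2 :&: w == set0)]| + 2 * q.-1.
Proof.
move=> z1Z z2Z z12; set E := [set w in Z | _].
have cD : q.-1 <= #|z1 :\: z2|.
  have := cardsID z2 z1; rewrite (hq z1Z); have := card_circleI z1Z z2Z z12; lia.
have lo : #|z1 :\: z2| * (q.+1 * (q - 2)) <=
    2 * \sum_(A in z1 :\: z2) #|[set w in E | A \in w]|.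
  rewrite big_distrr -sum_nat_const; apply: leq_sum => A /setDP[Az1 Az2].
  apply: leq_trans (card_through_disjoint z2Z Az2) _.
  rewrite leq_mul2l /=; apply: subset_leq_card; apply/subsetP => w.
  rewrite !inE => /and3P[-> Aw ->]; rewrite Aw !andbT.
  by apply/set0Pn; exists A; rewrite inE Az1.
have hi : \sum_(A in z1 :\: z2) #|[set w in E | A \in w]| <= 2 * #|E| + q.-1.
  rewrite double_counting.
  apply: (@leq_trans (\sum_(w in E) (2 + (w == z1) * q.-1))).
    apply: leq_sum => w; rewrite inE => /and3P[wZ _ _].
    case: eqP => [->|/eqP wz1].
      rewrite mul1n; apply: (@leq_trans #|z1|).
        by apply: subset_leq_card; apply/subsetP => A; rewrite !inE => /andP[].
      by rewrite hq //; have := order_gt1; lia.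
    rewrite addn0; apply: (@leq_trans #|z1 :&: w|).
      apply: subset_leq_card; apply/subsetP => A.
      by rewrite !inE => /andP[/andP[_ ->] ->].
    by apply: card_circleI => //; rewrite eq_sym.
  rewrite big_split /= sum_nat_const mulnC leq_add2l -big_distrl /=.
  rewrite -[X in _ <= X]mul1n leq_mul2r; apply/orP; right.
  case z1E : (z1 \in E).
    by rewrite (bigD1 z1) //= eqxx big1 // => w /andP[_ /negPf ->].
  by rewrite big1 // => w wE; case: eqP => // wz; rewrite wz z1E in wE.
have := leq_mul cD (leqnn (q.+1 * (q - 2))); lia.
Qed.

(** The circles meeting only z1 and those meeting only z2 form disjoint families, each of size at
    least about q^3 / 4. The gap between 1/2 and 2/5 absorbs the lower-order terms. *)
Lemma card_separating_circles (z1 z2 : {set P}) :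
  156 <= q -> z1 \in Z -> z2 \in Z -> z1 != z2 ->
  2 * #|Z| <= 5 * #|[set w in Z | (z1 :&: w == set0) != (z2 :&: w == set0)]|.
Proof.
move=> q156 z1Z z2Z z12.
have h1 := card_meeting_disjoint z1Z z2Z z12.
have z21 : z2 != z1 by rewrite eq_sym.
have h2 := card_meeting_disjoint z2Z z1Z z21.
set E1 := [set w in Z | _] in h1; set E2 := [set w in Z | _] in h2.
have -> : [set w in Z | (z1 :&: w == set0) != (z2 :&: w == set0)] = E1 :|: E2.
  apply/setP => w; rewrite !inE.
  by case: (w \in Z); case: (z1 :&: w == _); case: (z2 :&: w == _).
have h0 : E1 :&: E2 = set0.
  apply/setP => w; rewrite !inE.
  by case: (w \in Z); case: (z1 :&: w == _); case: (z2 :&: w == _).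
have := cardsUI E1 E2; rewrite h0 cards0 addn0 => ->.
have {h1 h2} : q.-1 * (q.+1 * (q - 2)) <= 2 * (#|E1| + #|E2|) + 2 * q.-1 by lia.
rewrite card_circles -mulnn; move: (#|E1| + #|E2|) => N.
have -> : q = (q - 156) + 156 by lia.
move: (q - 156) => m; rewrite -subn1; nia.
Qed.

(** * Tangent pencils and the resolution of points *)

(** For A on z, a parallel class of the affine plane derived at A. The circle z is added explicitly,
    since it does not meet itself in A alone. *)
Definition tangent_pencil (z : {set P}) (A : P) : {set {set P}} :=
  [set w in Z | (w == z) || (z :&: w == [set A])].

Lemma tangent_pencil_cover (z : {set P}) (A B : P) : z \in Z -> A \in z ->
  exists2 w, w \in tangent_pencil z A & B \in w.
Proof.
move=> zZ Az; case Bz : (B \in z); first by exists z; rewrite // inE zZ eqxx.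
have [w [[wZ Aw Bw zw] _]] := mobius_touch hZ zZ Az (negbT Bz).
by exists w; rewrite // inE wZ zw eqxx orbT.
Qed.

Lemma tangent_pencil_through (z w : {set P}) (A : P) :
  A \in z -> w \in tangent_pencil z A -> A \in w.
Proof.
move=> Az; rewrite inE => /andP[_ /orP[/eqP -> //|/eqP zw]].
by have := set11 A; rewrite -zw inE => /andP[].
Qed.

Lemma tangent_pencil_uniq (z w w' : {set P}) (A B : P) : z \in Z ->
  w \in tangent_pencil z A -> w' \in tangent_pencil z A ->
  B != A -> B \in w -> B \in w' -> w = w'.
Proof.
move=> zZ; rewrite !inE => /andP[wZ ww] /andP[w'Z ww'] BA Bw Bw'.
have out (u : {set P}) : B \in z -> B \in u -> z :&: u <> [set A].
  move=> Bz Bu zu; have : B \in z :&: u by rewrite inE Bz.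
  by rewrite zu inE (negPf BA).
case/orP: ww => /eqP hw; case/orP: ww' => /eqP hw'.
- by rewrite hw hw'.
- by case: (out w') => //; rewrite -hw.
- by case: (out w) => //; rewrite -hw'.
- exact: (touching_circle_uniq zZ wZ w'Z hw hw' BA).
Qed.

(** The members share only A, each has q further points, and there are q^2 points besides A. *)
Lemma card_tangent_pencil (z : {set P}) (A : P) : z \in Z -> A \in z ->
  #|tangent_pencil z A| <= q.
Proof.
move=> zZ Az; set E := tangent_pencil z A.
have : \sum_(B in [set~ A]) #|[set w in E | B \in w]| <= q ^ 2.
  have := cardsC1 A; rewrite card_points /= => <-; rewrite -sum1_card.
  apply: leq_sum => B; rewrite !inE => BA; apply/card_le1_eqP => w w'.
  rewrite !inE => /andP[wE Bw] /andP[w'E Bw'].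
  by apply: (@tangent_pencil_uniq z w' w A B); rewrite // inE.
rewrite double_counting (eq_bigr (fun=> q)); last first.
  move=> w wE; have Aw := tangent_pencil_through Az wE.
  move: wE; rewrite inE => /andP[wZ _].
  have := cardsD1 A w; rewrite Aw hq // add1n => -[->].
  by apply: eq_card => B; rewrite !inE.
by rewrite sum_nat_const -mulnn leq_pmul2r // ltnW // order_gt1.
Qed.

(* Two pencils of mutually tangent circles at A are two parallel classes of   *)
(* the affine plane derived at A, hence give coordinates to all other points. *)
Lemma point_resolving_circles : exists E : {set {set P}},
  [/\ E \subset Z, #|E| <= 2 * q, forall A, exists2 w, w \in E & A \in w
    & forall A B, A != B -> exists2 w, w \in E & (A \in w) != (B \in w)].
Proof.
have [A [B AB]] := two_points.
(* Two circles through A that meet again in B are not tangent, so their pencils at A are different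
   parallel classes. *)
have : 1 < #|[set z in Z | (A \in z) && (B \in z)]|.
  by rewrite card_through2 // ltnS ltnW // order_gt1.
case/card_gt1P=> z [z' []]; rewrite !inE => /and3P[zZ Az Bz] /and3P[z'Z Az' Bz'] zz'.
have BA : B != A by rewrite eq_sym.
pose E := tangent_pencil z A; pose E' := tangent_pencil z' A.
have subZ : E :|: E' \subset Z by apply/subsetP => w; rewrite !inE => /orP[] /andP[].
exists (E :|: E'); split=> //.
- have := cardsUI E E'; have := card_tangent_pencil zZ Az.
  by have := card_tangent_pencil z'Z Az'; rewrite -/E -/E'; lia.
- move=> C; have [w wE Cw] := tangent_pencil_cover C zZ Az.
  by exists w; rewrite // inE wE.
(* All members contain A, so a member missing C is wanted: z itself, or else any other member. *)
have sepA C : C != A -> exists2 w, w \in E :|: E' & (A \in w) != (C \in w).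
  move=> CA; have [D Dz] := mobius_proper hZ zZ.
  have [t tE Dt] := tangent_pencil_cover D zZ Az.
  have At := tangent_pencil_through Az tE.
  have zE : z \in E by rewrite inE zZ eqxx.
  case Cz : (C \in z); last by exists z; rewrite ?Az ?Cz // inE zE.
  exists t; first by rewrite inE tE.
  rewrite At; case Ct : (C \in t) => //.
  by rewrite (tangent_pencil_uniq zZ zE tE CA Cz Ct) Dt in Dz.
move=> C D CD; have [CA|CA] := eqVneq C A.
  by rewrite CA; apply: sepA; rewrite eq_sym -CA.
have [DA|DA] := eqVneq D A.
  by have [w wE hw] := sepA C CA; exists w; rewrite // DA eq_sym.
have [w wE Cw] := tangent_pencil_cover C zZ Az.
have [w' wE' Cw'] := tangent_pencil_cover C z'Z Az'.
case Dw : (D \in w); last by exists w; rewrite ?Cw ?Dw // inE wE.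
case Dw' : (D \in w'); last by exists w'; rewrite ?Cw' ?Dw' // inE wE' orbT.
have Aw := tangent_pencil_through Az wE.
have Aw' := tangent_pencil_through Az' wE'.
(* Unresolved C and D would put A, C, D on both w and w'. This common member is equal or tangent to
   each of z and z', which share B, so z = z'. *)
have ww' : w = w'.
  apply: (circle_uniq CA CD) => //; first by rewrite eq_sym.
    by move: wE; rewrite inE => /andP[].
  by move: wE'; rewrite inE => /andP[].
rewrite -{}ww' in wE' Aw' {Cw' Dw'}; case/eqP: zz'.
have zE : z \in E by rewrite inE zZ eqxx.
have zE' : z' \in E' by rewrite inE z'Z eqxx.
move: wE wE'; rewrite !inE => /andP[wZ /orP[/eqP wz|/eqP zw]] /andP[_ wz'].
  rewrite -wz; apply: (tangent_pencil_uniq z'Z _ zE' BA) => //; last by rewrite wz.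
  by rewrite inE wZ wz'.
case/orP: wz' => /eqP z'w.
  rewrite -z'w; apply: (tangent_pencil_uniq zZ zE _ BA) => //; last by rewrite z'w.
  by rewrite inE wZ zw eqxx orbT.
apply: (@touching_circle_uniq w z z' A B) => //; by rewrite setIC.
Qed.

(** * Distances in the incidence graph *)

(** Keeps the lengths up to 3 within the search range of [gdist]. *)
Lemma card_vertex_gt4 : 4 < #|vertex Z|.
Proof.
rewrite card_sum card_points -mulnn; have := order_gt1; nia.
Qed.

Lemma incidence_irr : irreflexive (incidence Z).
Proof. by case. Qed.

Lemma gdist_incidence (u v : vertex Z) :
  (gdist (incidence Z) u v == 1) = incidence Z u v.
Proof. by apply: gdist_eq1 incidence_irr; apply: ltn_trans card_vertex_gt4. Qed.

(** A walk of length 2 between circles passes through a common point; the bound also covers z = s at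
    distance 0. *)
Lemma gdist_circles_le2 (z s : circle Z) :
  (gdist (incidence Z) (inr z) (inr s) <= 2) = (val z :&: val s != set0).
Proof.
have V4 := card_vertex_gt4; apply/idP/idP => [d2|/set0Pn[A /setIP[Az As]]]; last first.
  apply: gdist_le; first exact: ltn_trans V4.
  by rewrite has_walkS; apply/existsP; exists (inl A); rewrite has_walk1 /= Az.
have := has_walk_gdist (leq_ltn_trans d2 (ltn_trans (isT : 2 < 4) V4)).
case: (gdist _ _ _) d2 => [|[|[|//]]] _.
- rewrite has_walk0 => /eqP[<-]; rewrite setIid -card_gt0.
  exact: leq_trans (mobius_circle_ge3 hZ (valP z)).
- by rewrite has_walk1.
- rewrite has_walkS => /existsP[[A|//]]; rewrite has_walk1 /= => /andP[Az As].
  by apply/set0Pn; exists A; rewrite inE Az.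
Qed.

Lemma circle_through2 (A B : P) : A != B ->
  exists z : circle Z, (A \in val z) && (B \in val z).
Proof.
move=> AB; have /card_gt0P[z] : 0 < #|[set z in Z | (A \in z) && (B \in z)]|.
  by rewrite card_through2.
by rewrite inE => /andP[zZ ABz]; exists (exist _ z zZ).
Qed.

Lemma gdist_points (A B : P) : A != B ->
  gdist (incidence Z) (inl A) (inl B) = 2.
Proof.
move=> AB; have [z /andP[Az Bz]] := circle_through2 AB.
apply: gdist_eq => [||[|[|//]] _].
- exact: ltn_trans card_vertex_gt4.
- by rewrite has_walkS; apply/existsP; exists (inr z); rewrite has_walk1 /= Az.
- by rewrite has_walk0; apply: contra AB => /eqP[->].
- by rewrite has_walk1.
Qed.

Lemma gdist_point_circle (A : P) (s : circle Z) :
  gdist (incidence Z) (inl A) (inr s) = if A \in val s then 1 else 3.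
Proof.
case: ifP => As; first by apply/eqP; rewrite gdist_incidence.
have /card_gt0P[C Cs] : 0 < #|val s|.
  exact: leq_trans (mobius_circle_ge3 hZ (valP s)).
have AC : A != C by apply: contraFneq As => ->.
have [z /andP[Az Cz]] := circle_through2 AC.
apply: gdist_eq => [||[|[|[|//]]] _].
- exact: ltn_trans card_vertex_gt4.
- rewrite has_walkS; apply/existsP; exists (inr z); rewrite /= Az has_walkS.
  by apply/existsP; exists (inl C); rewrite has_walk1 /= Cz.
- by rewrite has_walk0.
- by rewrite has_walk1 /= As.
- by rewrite has_walkS; apply/existsPn => -[B|w]; rewrite ?has_walk1 /= ?andbF.
Qed.

(** * The weighted lower bound *)

Section LowerBound.
Variable S : {set vertex Z}.
Hypothesis resS : resolving_set (incidence Z) S.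

Definition trace (A : P) : {set circle Z} :=
  [set s in circles_in S | A \in val s].

(** A point of S is at distance 2 from both A and B, and a circle is at distance 1 or 3 according to
    incidence, so only traces can resolve A and B. *)
Lemma trace_inj :
  {in ~: [set A | (inl A : vertex Z) \in S] &, injective trace}.
Proof.
move=> A B; rewrite !inE => AS BS tAB; apply/eqP; apply: contraT => AB.
have /forall_inP/(_ (inl A) (in_setT _))/forall_inP/(_ (inl B) (in_setT _)) := resS.
have -> : (inl A : vertex Z) != inl B by apply: contra AB => /eqP[->].
case/exists_inP=> -[C|s] sS.
  rewrite !gdist_points ?eqxx //.
    by apply: contraNneq BS => ->.
  by apply: contraNneq AS => ->.
move/setP/(_ s): tAB; rewrite !inE sS /= => h.
by rewrite !gdist_point_circle h eqxx.
Qed.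

(** Sum 2 <= t + [t = 1] + 2 [t = 0] over the points outside S, where t is the size of the trace. By
    injectivity the last two terms contribute at most c and 2. *)
Lemma resolving_set_weight :
  2 * q ^ 2 <= #|circles_in S| * (q + 2) + 2 * #|[set A | (inl A : vertex Z) \in S]|.
Proof.
set Q := [set A | _]; set C := circles_in S; set W := ~: Q.
have s1 : \sum_(A in W) #|trace A| <= #|C| * q.+1.
  rewrite (double_counting W C (fun A (s : circle Z) => A \in val s)) -sum_nat_const.
  apply: leq_sum => s _; rewrite -(hq (valP s)).
  by apply: subset_leq_card; apply/subsetP => A; rewrite inE => /andP[].
have sub_card n (X : {set {set circle Z}}) :
    (forall A, A \in W -> #|trace A| = n -> trace A \in X) ->
    \sum_(A in W) (#|trace A| == n) <= #|X|.
  move=> hX; have -> : \sum_(A in W) (#|trace A| == n) = #|[set A in W | #|trace A| == n]|.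
    rewrite -sum1dep_card big_mkcond [RHS]big_mkcond; apply: eq_bigr => A _.
    by case: (A \in W); case: (_ == n).
  rewrite -(@card_in_imset _ _ trace); last first.
    by move=> A B /setIdP[AW _] /setIdP[BW _]; apply: trace_inj.
  by apply: subset_leq_card; apply/subsetP => t /imsetP[A /setIdP[AW /eqP An] ->]; apply: hX.
have s2 : \sum_(A in W) (#|trace A| == 1) <= #|C|.
  apply: leq_trans (leq_imset_card (fun s => [set s]) C); apply: sub_card => A _.
  move/eqP/cards1P=> [s ts]; rewrite ts imset_f //.
  by have := set11 s; rewrite -ts inE => /andP[].
have s3 : \sum_(A in W) (#|trace A| == 0) <= 1.
  rewrite -(cards1 (set0 : {set circle Z})); apply: sub_card => A _ /eqP.
  by rewrite cards_eq0 inE.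
have : #|W| * 2 <= \sum_(A in W) #|trace A| + \sum_(A in W) (#|trace A| == 1)
    + 2 * \sum_(A in W) (#|trace A| == 0).
  rewrite big_distrr -!big_split -sum_nat_const; apply: leq_sum => A _ /=.
  by case: #|_| => [|[|m]].
have := cardsC Q; rewrite card_points -/W; lia.
Qed.

Lemma card_resolving_set :
  #|S| = #|[set A | (inl A : vertex Z) \in S]| + #|circles_in S|.
Proof. exact: card_sum_set. Qed.

End LowerBound.

(** * A small resolving set of circles *)

Lemma card_circle_set (p : pred {set P}) :
  #|[set s : circle Z | p (val s)]| = #|[set z in Z | p z]|.
Proof.
rewrite -(card_imset _ val_inj); apply: eq_card => z; rewrite !inE.
apply/imsetP/andP => [[s]|[zZ pz]]; first by rewrite inE => ps ->; split=> //; apply: valP.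
by exists (exist _ z zZ); rewrite // inE.
Qed.

Lemma card_circle : #|circle Z| = #|Z|.
Proof.
by rewrite card_sig; apply: eq_card.
Qed.

Lemma circle_resolving_circles : 156 <= q -> exists2 T : {set circle Z},
  #|T| <= q %/ 2 - 1 &
  forall z1 z2 : circle Z, z1 != z2 -> exists2 s, s \in T &
    (val z1 :&: val s == set0) != (val z2 :&: val s == set0).
Proof.
move=> q156; set k := q %/ 2 - 1.
pose D := [set p : circle Z * circle Z | p.1 != p.2].
pose r (p : circle Z * circle Z) (s : circle Z) :=
  (val p.1 :&: val s == set0) != (val p.2 :&: val s == set0).
have circle_gt0 : 0 < #|circle Z|.
  by rewrite card_circle card_circles muln_gt0 andbT; lia.
have rD p : p \in D -> 2 * #|circle Z| <= 5 * #|[set s | r p s]|.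
  rewrite inE => p12; rewrite card_circle.
  rewrite (card_circle_set (fun w => (val p.1 :&: w == set0) != (val p.2 :&: w == set0))).
  exact: (card_separating_circles q156 (valP _) (valP _)).
have [T Tk hT] := greedy_hitting_set circle_gt0 (isT : 2 <= 5) rD k.
exists T => // z1 z2 z12.
set U := [set _ in D | _] in hT.
have : #|U| = 0.
  (* |Z| = q (q^2 + 1) <= (q + 1)^3, and q + 1 <= 2 (k + 2) despite the rounding in q / 2. *)
  have cD : #|D| <= 2 ^ 6 * (k + 2) ^ 6.
    apply: (@leq_trans (#|Z| ^ 2)).
      by rewrite -card_circle -mulnn -card_prod max_card.
    have -> : 2 ^ 6 * (k + 2) ^ 6 = ((2 * (k + 2)) ^ 3) ^ 2.
      by rewrite -expnM expnMn.
    rewrite leq_exp2r // card_circles.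
    apply: (@leq_trans (q.+1 ^ 3)); first by rewrite !expnS !expn0; nia.
    by rewrite leq_exp2r // /k; lia.
  have k77 : 77 <= k by rewrite /k; lia.
  have : 3 ^ k * #|D| < 5 ^ k.
    apply: leq_ltn_trans (greedy_rounds_suffice k77).
    by rewrite mulnC leq_mul2r cD orbT.
  move/(leq_ltn_trans hT).
  by rewrite -[X in _ < X]muln1 ltn_pmul2l ?expn_gt0 // ltnS leqn0 => /eqP.
move/eqP; rewrite cards_eq0 => /eqP/setP/(_ (z1, z2)); rewrite !inE z12 /=.
by move/negbFE/exists_inP.
Qed.

Lemma metric_dimension_upper : 156 <= q ->
  metric_dimension (incidence Z) <= 2 * q + (q %/ 2 - 1).
Proof.
move=> q156; have [T Tk hT] := circle_resolving_circles q156.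
have [E [EZ Eq cov sep]] := point_resolving_circles.
pose C : {set circle Z} := [set s | val s \in E] :|: T.
have inC w : w \in E -> exists2 s : circle Z, (inr s : vertex Z) \in inr @: C & val s = w.
  move=> wE; exists (exist _ w (subsetP EZ w wE)) => //.
  by rewrite imset_f // !inE wE.
apply: leq_trans (metric_dimension_min (S := inr @: C) _) _; last first.
  apply: leq_trans (leq_imset_card _ _) _; apply: leq_trans (leq_card_setU _ _) _.
  rewrite leq_add // (card_circle_set (mem E)).
  by apply: leq_trans Eq; apply: subset_leq_card; apply/subsetP => w; rewrite inE => /andP[].
(* A chosen circle through A is at distance 1 from A, but never at distance 1 from a circle. *)
have sepPC A z : exists2 s, s \in inr @: C &
    gdist (incidence Z) (inl A) s != gdist (incidence Z) (inr z) s.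
  have [w wE Aw] := cov A; have [s sC sw] := inC w wE; exists (inr s) => //.
  have /eqP -> : gdist (incidence Z) (inl A) (inr s) == 1.
    by rewrite gdist_incidence /= sw.
  by rewrite eq_sym gdist_incidence.
apply/forall_inP => u _; apply/forall_inP => v _; apply/implyP => uv.
apply/exists_inP; case: u v uv => [A|z] [B|z'] uv //.
- have AB : A != B by apply: contra uv => /eqP ->.
  have [w wE hw] := sep A B AB; have [s sC sw] := inC w wE; exists (inr s) => //.
  by rewrite !gdist_point_circle sw; move: hw; case: (A \in w); case: (B \in w).
- by have [s sC hs] := sepPC B z; exists s; rewrite // eq_sym.
have zz' : z != z' by apply: contra uv => /eqP ->.
have [s sT hs] := hT z z' zz'; exists (inr s); first by rewrite imset_f // inE sT orbT.
apply: contra hs => /eqP hs; apply/eqP/negb_inj.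
by rewrite -!gdist_circles_le2 hs.
Qed.

End MobiusPlane.

Theorem mainTheorem4 (P : finType) (Z : {set {set P}}) (q : nat)
    (hZ : mobius_plane Z) (hq : mobius_order Z q) :
  [/\ (Num.ceil (2 * q%:R - 4 + 8 / (q%:R + 2) : rat)
         <= (metric_dimension (incidence Z))%:Z)%R,
      (2 * q%:Z - 3 <= Num.ceil (2 * q%:R - 4 + 8 / (q%:R + 2) : rat))%R
    & 156 <= q ->
      forall S : {set vertex Z},
        resolving_set (incidence Z) S ->
        #|S| = metric_dimension (incidence Z) ->
        2 * q - 4 <= #|circles_in S| ].
Proof.
have q2_gt0 : (0 < q%:R + 2 :> rat)%R by rewrite ltr_wpDl // ler0n.
split.
- have [S resS cS] := metric_dimension_attained (incidence Z).
  have := resolving_set_weight hZ hq resS; have := card_resolving_set S.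
  rewrite cS; move: (metric_dimension _) => n hn hw.
  (* Points are given the larger weight q + 2 as well. *)
  have {hn}hw : 2 * q ^ 2 <= n * (q + 2) by nia.
  rewrite ceil_le_int.
  have -> : (2 * q%:R - 4 + 8 / (q%:R + 2) = 2 * q%:R ^+ 2 / (q%:R + 2) :> rat)%R.
    by field; rewrite gt_eqF.
  rewrite ler_pdivrMr // -natrX -[2%R]/(2%:R)%R -!natrM -natrD -natrM ler_nat.
  exact: hw.
(* The term 8 / (q + 2) is positive, so the ceiling exceeds the integer 2 q - 4. *)
- have : (2 * q%:R - 4 < (Num.ceil (2 * q%:R - 4 + 8 / (q%:R + 2) : rat))%:~R :> rat)%R.
    by apply: lt_le_trans (ceil_ge _); rewrite ltrDl divr_gt0.
  rewrite (_ : (2 * q%:R - 4 = (2 * q%:Z - 4)%:~R :> rat)%R) ?ltr_int; first by lia.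
  by rewrite rmorphB rmorphM.
(* With c <= 2 q - 5 the weight inequality gives 2 |S| >= 5 q, while the upper bound gives 2 |S| <=
   5 q - 2. *)
move=> q156 S resS cS; rewrite leqNgt; apply/negP => hC.
have := metric_dimension_upper hZ hq q156; rewrite -cS.
have := resolving_set_weight hZ hq resS; have := card_resolving_set S.
move: hC; rewrite -mulnn; nia.
Qed.
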